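(* Let $m\ge 3$ and let $G$ be a finite group such that $G/Z(G)\cong D_{2m}$. Let $n=|Z(G)|$. Then \[ M_1(\mathcal{C}(G))=n(m-1)(mn-n-1)^2+mn(n-1)^2, \] \[ M_2(\mathcal{C}(G))=\frac{(mn-n)(mn-n-1)^3+mn(n-1)^3}{2}, \] \[ M_1(\mathcal{NC}(G))=n^3(5m^3-9m^2+4m), \qquad M_2(\mathcal{NC}(G))=n^4(4m^4-10m^3+8m^2-2m). \] Further, for $\Gamma(G)=\mathcal{C}(G)$ and for $\Gamma(G)=\mathcal{NC}(G)$, \[ \frac{M_2(\Gamma(G))}{|e(\Gamma(G))|}>\frac{M_1(\Gamma(G))}{|v(\Gamma(G))|}. \]
   Context: $D_{2m}=\langle f,g: f^m=g^2=1,\ gfg^{-1}=f^{-1}\rangle$ is the dihedral group of order $2m$. For a finite simple undirected graph $\Gamma$ with vertex set $v(\Gamma)$ and edge set $e(\Gamma)$, the first and second Zagreb indices are $M_1(\Gamma)=\sum_{v\in v(\Gamma)}\deg(v)^2$ and $M_2(\Gamma)=\sum_{uv\in e(\Gamma)}\deg(u)\deg(v)$. For a finite non-abelian group $G$ with center $Z(G)$, the commuting graph $\mathcal{C}(G)$ is the simple graph with vertex set $G\setminus Z(G)$ in which two distinct vertices $x,y$ are adjacent iff $xy=yx$; the non-commuting graph $\mathcal{NC}(G)$ is the complement of $\mathcal{C}(G)$ (same vertex set, distinct $x,y$ adjacent iff $xy\ne yx$). *)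

(* Defs.v *)
From HB Require Import structures.
From mathcomp Require Import all_boot all_order all_algebra all_fingroup all_solvable.

Set Implicit Arguments.
Unset Strict Implicit.
Unset Printing Implicit Defensive.

Import GroupScope.

(* The vertices form a subset of an ambient finite type; [adj] is only
   consulted on that subset. *)
Record sgraph (T : finType) := SGraph {
  vertices : {set T};
  adj : rel T;
  adj_sym : symmetric adj;
  adj_irr : irreflexive adj
}.

Section Zagreb.
Variables (T : finType) (Gamma : sgraph T).

(* An edge is the two-element set of its endpoints, so that each undirected
   edge is counted once. *)
Definition edges : {set {set T}} :=
  [set [set x; y] | x in vertices Gamma, y in vertices Gamma & adj Gamma x y].

Definition deg (x : T) : nat := #|[set y in vertices Gamma | adj Gamma x y]|.

Definition zagreb1 : nat := (\sum_(x in vertices Gamma) deg x ^ 2)%N.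

Definition zagreb2 : nat := (\sum_(e in edges) \prod_(x in e) deg x)%N.

Lemma compl_sym : symmetric [rel x y | (x != y) && ~~ adj Gamma x y].
Proof. by move=> x y /=; rewrite eq_sym adj_sym. Qed.

Lemma compl_irr : irreflexive [rel x y | (x != y) && ~~ adj Gamma x y].
Proof. by move=> x /=; rewrite eqxx. Qed.

Definition compl_graph : sgraph T :=
  SGraph (vertices Gamma) compl_sym compl_irr.

End Zagreb.

Section Commuting.
Variables (gT : finGroupType) (G : {group gT}).

Lemma commuting_sym : symmetric [rel x y : gT | (x != y) && (x * y == y * x)].
Proof. by move=> x y /=; rewrite eq_sym [x * y == _]eq_sym. Qed.

Lemma commuting_irr : irreflexive [rel x y : gT | (x != y) && (x * y == y * x)].
Proof. by move=> x /=; rewrite eqxx. Qed.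

Definition commuting_graph : sgraph gT :=
  SGraph (G :\: 'Z(G)) commuting_sym commuting_irr.

Definition noncommuting_graph : sgraph gT := compl_graph commuting_graph.

Lemma noncommuting_adjE x y :
  adj noncommuting_graph x y = (x != y) && (x * y != y * x).
Proof. by rewrite /=; case: (x =P y). Qed.

End Commuting.

(* Main.v *)
(* Since G / Z(G) is dihedral of order 2m, the preimage A of its rotation
   subgroup is an abelian subgroup of index 2 and order mn.  A non-central x in
   A has centralizer A; any x outside A meets A only in Z(G), so its
   centralizer has order 2n.  Thus each graph has only two degrees, one on
   A \ Z(G) and one on G \ A.  In the commuting graph adjacent vertices have
   equal degrees; in the non-commuting graph A \ Z(G) is independent and joined
   to all of G \ A.  With a = |A|, b = |A| - n, the two inequalities reduce to
   a b (p - q)^2 (p + q) > 0, where p and q are the two commuting degrees, and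
   to a b^2 (a - 2b)^2 > 0. *)
Require Import Defs.
From mathcomp Require Import all_boot all_order all_algebra all_fingroup all_solvable.
From mathcomp Require Import ring zify.
Import GRing.Theory Num.Theory.

Set Implicit Arguments.
Unset Strict Implicit.
Unset Printing Implicit Defensive.

(** * Counting edges through ordered pairs of adjacent vertices *)

Section DoubleCounting.
Variables (T : finType) (Gamma : sgraph T).
Local Notation V := (vertices Gamma).
Local Open Scope nat_scope.

Lemma adj_neq x y : adj Gamma x y -> x != y.
Proof. by apply: contraTneq => ->; rewrite adj_irr. Qed.

Lemma edgesP e :
  reflect (exists x y, [/\ x \in V, y \in V, adj Gamma x y & e = [set x; y]])
          (e \in edges Gamma).
Proof.
apply: (iffP imset2P) => [[x y Vx]|[x [y [Vx Vy xy ->]]]].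
  by rewrite inE => /andP[Vy xy] ->; exists x, y.
by apply: (Imset2spec Vx) => //; rewrite inE Vy.
Qed.

(** The fibre over an edge [[set x; y]] consists of [(x, y)] and [(y, x)], which differ because
    adjacency is irreflexive. *)
Lemma sum_edges (F : {set T} -> nat) :
  \sum_(x in V) \sum_(y in V | adj Gamma x y) F [set x; y]
    = 2 * \sum_(e in edges Gamma) F e.
Proof.
rewrite pair_big_dep /=.
rewrite (partition_big (fun p : T * T => [set p.1; p.2]) (mem (edges Gamma)))
  => [|[x y] /= /and3P[Vx Vy xy]]; last by apply/edgesP; exists x, y.
rewrite big_distrr; apply: eq_bigr => e /edgesP[x [y [Vx Vy xy ->]]].
rewrite (eq_bigl (fun p => p \in [set (x, y); (y, x)])) => [|[a b]].
  rewrite big_setU1 ?big_set1 /= => [|/[!inE]].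
    by rewrite (setUC [set y]) mul2n addnn.
  by rewrite xpair_eqE (negPf (adj_neq xy)).
rewrite !inE !xpair_eqE /=; apply/andP/idP => [[/and3P[_ _ ab] /eqP eq_e]|].
  move: (set22 a b) (set21 a b) (adj_neq ab); rewrite eq_e !inE.
  by move=> /orP[]/eqP-> /orP[]/eqP->; rewrite ?eqxx ?orbT.
case/orP=> /andP[/eqP-> /eqP->]; first by rewrite Vx Vy xy eqxx.
by rewrite Vx Vy adj_sym xy setUC eqxx.
Qed.

Lemma sum_deg : \sum_(x in V) deg Gamma x = 2 * #|edges Gamma|.
Proof.
rewrite -sum1_card -sum_edges; apply: eq_bigr => x _.
by rewrite sum1dep_card.
Qed.

(** Adjacent vertices differ, so the product over [[set x; y]] really has two factors. The doubled
    form avoids division in [nat]. *)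
Lemma zagreb2_double :
  2 * zagreb2 Gamma
    = \sum_(x in V) deg Gamma x * \sum_(y in V | adj Gamma x y) deg Gamma y.
Proof.
rewrite -sum_edges; apply: eq_bigr => x _; rewrite big_distrr.
apply: eq_bigr => y /andP[_ /adj_neq neq_xy].
by rewrite big_setU1 ?inE // big_set1.
Qed.

End DoubleCounting.

(** * Centralizers in a nonabelian group with an abelian subgroup of index two *)

Section AbelianIndexTwo.
Variables (gT : finGroupType) (G A : {group gT}).
Hypotheses (sAG : A \subset G) (cAA : abelian A) (iAG : #|G : A|%g = 2).
Hypothesis nab : ~~ abelian G.
Local Open Scope group_scope.
Local Notation Z := 'Z(G).

(** The index is prime, so [A] is a maximal subgroup. *)
Lemma index2_max (H : {group gT}) :
  A \subset H -> H \subset G -> H \subset A \/ G \subset H.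
Proof.
move=> sAH sHG; have /maximal_eqP[_ /(_ H sAH sHG)] : maximal_eq A G.
  by rewrite /maximal_eq; apply/orP; right; apply: p_index_maximal; rewrite ?iAG.
by case=> ->; [left | right].
Qed.

Lemma cent1_eq_center x : x \in G -> G \subset 'C_G[x] -> x \in Z.
Proof. by move=> Gx; rewrite subsetI subxx sub_cent1 inE Gx. Qed.

(** A central element outside [A] would force [A <*> Z] to be all of [G] by maximality, yet this
    join is abelian. *)
Lemma center_sub_abelian_index2 : Z \subset A.
Proof.
apply/subsetP=> z Zz; apply/idPn => nAz; case/negP: nab.
have [Gz cGz] := setIP Zz.
have sAZA : A \subset A <*> Z by apply: joing_subl.
have [|sA|sG] := index2_max sAZA.
- by rewrite join_subG sAG center_sub.
- by case/negP: nAz; apply: (subsetP sA); apply: (subsetP (joing_subr _ _)).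
apply: abelianS sG _; rewrite abelianY cAA center_abelian /=.
by apply: subset_trans (subsetIr _ _) (centS sAG).
Qed.

(** The centralizer contains the abelian group [A]; by maximality the only alternative is [G], which
    would make [x] central. *)
Lemma cent1_in_abelian_index2 x : x \in A :\: Z -> 'C_G[x] = A.
Proof.
case/setDP=> Ax nZx; have Gx := subsetP sAG x Ax.
have sAC : A \subset 'C_G[x] by rewrite subsetI sAG sub_cent1 (subsetP cAA).
have [|sCA|sGC] := index2_max sAC; first exact: subsetIl.
- by apply/eqP; rewrite eqEsubset sCA.
- by case/negP: nZx; apply: cent1_eq_center.
Qed.

(** A noncentral [a] in [A] commuting with [x] would put [x] in ['C_G[a] = A]. *)
Lemma cent1_notin_abelian_index2_cap x :
  x \in G :\: A -> 'C_G[x] :&: A = Z.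
Proof.
case/setDP=> Gx nAx; apply/eqP; rewrite eqEsubset; apply/andP; split.
  apply/subsetP=> a /setIP[/setIP[Ga cxa] Aa]; apply: contraR nAx => nZa.
  rewrite -(@cent1_in_abelian_index2 a); last by apply/setDP.
  by rewrite in_setI Gx cent1C.
rewrite subsetI center_sub_abelian_index2 andbT setIS //.
by rewrite -cent_set1 centS // sub1set.
Qed.

(** Maximality and normality of [A] give ['C_G[x] * A = G]; the product formula then yields the
    order, the intersection being [Z]. *)
Lemma card_cent1_notin_abelian_index2 x :
  x \in G :\: A -> #|'C_G[x]| = (2 * #|Z|)%N.
Proof.
move=> xGA; have [Gx nAx] := setDP xGA.
have nAC : 'C_G[x] \subset 'N(A).
  by apply: subset_trans (subsetIl _ _) (normal_norm (index2_normal sAG iAG)).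
have [|sA|sG] := index2_max (joing_subl A 'C_G[x]).
- by rewrite join_subG sAG subsetIl.
- by case/negP: nAx; apply: (subsetP sA); apply: (subsetP (joing_subr _ _));
    rewrite in_setI Gx cent1id.
have defG : 'C_G[x] * A = G.
  apply/eqP; rewrite -norm_joinEl // joingC eqEsubset sG join_subG sAG.
  by rewrite subsetIl.
have := mul_cardG 'C_G[x] A.
rewrite defG (cent1_notin_abelian_index2_cap xGA) -(Lagrange sAG) iAG.
by rewrite [LHS]mulnC -mulnA => /eqP; rewrite eqn_pmul2l // => /eqP.
Qed.

(** * The two classes of vertices and their degrees *)

Lemma sum_noncentral (F : gT -> nat) :
  (\sum_(x in G :\: Z) F x
     = \sum_(x in A :\: Z) F x + \sum_(x in G :\: A) F x)%N.
Proof.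
rewrite (bigID (mem A)) /=; congr (_ + _)%N; apply: eq_bigl => x.
  rewrite !in_setD andbC andbCA; congr (_ && _); apply: andb_idr.
  exact: (subsetP sAG).
rewrite !in_setD andbAC andbC andbA -andbA.
case Gx: (x \in G); rewrite ?andbF ?andbT //=.
by apply: andb_idl; apply: contra; apply: (subsetP center_sub_abelian_index2).
Qed.

Lemma commuting_deg x : x \in G :\: Z ->
  deg (commuting_graph G) x = (#|'C_G[x]| - #|Z| - 1)%N.
Proof.
case/setDP=> Gx nZx.
have sZC : Z \subset 'C_G[x] by rewrite setIS // -cent_set1 centS ?sub1set.
have Cx : x \in 'C_G[x] :\: Z by rewrite in_setD nZx in_setI Gx cent1id.
(* Central elements are not vertices, and the extra 1 accounts for [x], which is not its own
   neighbour. *)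
rewrite -(setIidPr sZC) -cardsD (cardsD1 x) Cx add1n subn1; apply: eq_card => y.
rewrite [LHS]inE /= !in_setD in_set1 [y \in 'C_G[x]]in_setI cent1E eq_sym
        [y * x == _]eq_sym.
by rewrite andbCA -!andbA.
Qed.

Lemma noncommuting_deg x : x \in G :\: Z ->
  deg (noncommuting_graph G) x = (#|G| - #|'C_G[x]|)%N.
Proof.
case/setDP=> Gx nZx.
(* Removing the centralizer already removes both [Z] and [x], so no further correction appears. *)
rewrite -(setIidPr (subsetIl G 'C[x])) -cardsD; apply: eq_card => y.
rewrite [LHS]inE noncommuting_adjE /= !in_setD [y \in 'C_G[x]]in_setI cent1E
        [y * x == _]eq_sym.
case Gy: (y \in G); rewrite ?andbF // !andbT /= andbA; apply: andb_idl => nxy.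
apply/andP; split; first by apply: contra nxy => /setIP[_ /centP->].
by apply: contraNneq nxy => ->.
Qed.

Lemma card_noncentral_in_abelian_index2 : #|A :\: Z| = (#|A| - #|Z|)%N.
Proof. by rewrite cardsD (setIidPr center_sub_abelian_index2). Qed.

Lemma card_abelian_index2 : #|G| = (2 * #|A|)%N.
Proof. by rewrite -(Lagrange sAG) iAG mulnC. Qed.

Lemma card_notin_abelian_index2 : #|G :\: A| = #|A|.
Proof. by rewrite cardsD (setIidPr sAG) card_abelian_index2 mul2n -addnn addnK. Qed.

Lemma noncentral_in x : x \in A :\: Z -> x \in G :\: Z.
Proof. by apply: subsetP; apply: setSD. Qed.

Lemma noncentral_notin x : x \in G :\: A -> x \in G :\: Z.
Proof. by apply: subsetP; apply: setDS center_sub_abelian_index2. Qed.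

Lemma sum_noncentral_const (F : gT -> nat) c d :
    {in A :\: Z, forall x, F x = c} -> {in G :\: A, forall x, F x = d} ->
  (\sum_(x in G :\: Z) F x = (#|A| - #|Z|) * c + #|A| * d)%N.
Proof.
move=> Fc Fd; rewrite sum_noncentral (eq_bigr _ Fc) (eq_bigr _ Fd) !sum_nat_const.
by rewrite card_noncentral_in_abelian_index2 card_notin_abelian_index2.
Qed.

Lemma card_noncentral : #|G :\: Z| = (2 * #|A| - #|Z|)%N.
Proof. by rewrite cardsD (setIidPr (center_sub G)) card_abelian_index2. Qed.

Lemma commuting_deg_in x :
  x \in A :\: Z -> deg (commuting_graph G) x = (#|A| - #|Z| - 1)%N.
Proof.
move=> xAZ.
by rewrite commuting_deg ?noncentral_in ?cent1_in_abelian_index2.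
Qed.

Lemma commuting_deg_notin x :
  x \in G :\: A -> deg (commuting_graph G) x = (#|Z| - 1)%N.
Proof.
move=> xGA; rewrite commuting_deg ?noncentral_notin //.
by rewrite card_cent1_notin_abelian_index2 // mul2n -addnn addnK.
Qed.

Lemma noncommuting_deg_in x :
  x \in A :\: Z -> deg (noncommuting_graph G) x = #|A|.
Proof.
move=> xAZ; rewrite noncommuting_deg ?noncentral_in // cent1_in_abelian_index2 //.
by rewrite card_abelian_index2 mul2n -addnn addnK.
Qed.

Lemma noncommuting_deg_notin x :
  x \in G :\: A -> deg (noncommuting_graph G) x = (2 * (#|A| - #|Z|))%N.
Proof.
move=> xGA; rewrite noncommuting_deg ?noncentral_notin //.
by rewrite card_cent1_notin_abelian_index2 // card_abelian_index2 mulnBr.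
Qed.

Lemma noncommuting_adj_in x y :
    x \in A :\: Z -> y \in G ->
  adj (noncommuting_graph G) x y = (y \notin A).
Proof.
move=> xAZ Gy; rewrite -(cent1_in_abelian_index2 xAZ) noncommuting_adjE.
rewrite in_setI Gy cent1E [y * x == _]eq_sym.
by apply: andb_idl; apply: contraNneq => ->.
Qed.

Lemma commuting_adj_in x y :
    x \in A :\: Z -> y \in G -> adj (commuting_graph G) x y -> y \in A.
Proof.
move=> xAZ Gy /andP[_ /eqP xy]; rewrite -(cent1_in_abelian_index2 xAZ).
by rewrite in_setI Gy cent1E xy eqxx.
Qed.

(** No commuting pair joins [A :\: Z] to [G :\: A], and the degree is constant on each class. *)
Lemma commuting_adj_deg x y :
    x \in G :\: Z -> y \in G :\: Z -> adj (commuting_graph G) x y ->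
  deg (commuting_graph G) y = deg (commuting_graph G) x.
Proof.
move=> /setDP[Gx nZx] /setDP[Gy nZy] xy; have yx := xy; rewrite adj_sym in yx.
have [Ax | nAx] := boolP (x \in A).
  have xAZ : x \in A :\: Z by apply/setDP.
  have Ay := commuting_adj_in xAZ Gy xy.
  by rewrite !commuting_deg_in //; apply/setDP.
have [Ay | nAy] := boolP (y \in A); last first.
  by rewrite !commuting_deg_notin //; apply/setDP.
by case/negP: nAx; apply: commuting_adj_in yx => //; apply/setDP.
Qed.

(** * Zagreb indices and edge counts in terms of [#|A|] and [#|Z|] *)

Lemma zagreb1_commuting :
  zagreb1 (commuting_graph G)
    = ((#|A| - #|Z|) * (#|A| - #|Z| - 1) ^ 2 + #|A| * (#|Z| - 1) ^ 2)%N.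
Proof.
apply: sum_noncentral_const => x xV.
  by rewrite commuting_deg_in.
by rewrite commuting_deg_notin.
Qed.

Lemma zagreb2_commuting :
  (2 * zagreb2 (commuting_graph G)
    = (#|A| - #|Z|) * (#|A| - #|Z| - 1) ^ 3 + #|A| * (#|Z| - 1) ^ 3)%N.
Proof.
rewrite zagreb2_double.
under eq_bigr => x xV.
  rewrite (eq_bigr (fun=> deg (commuting_graph G) x)) => [|y /andP[yV]]; last first.
    exact: commuting_adj_deg.
  (* All neighbours share the degree of [x], so each vertex contributes the cube of its degree. *)
  rewrite sum_nat_cond_const -/(deg _ x) mulnn -expnS.
  over.
apply: sum_noncentral_const => x xV.
  by rewrite commuting_deg_in.
by rewrite commuting_deg_notin.
Qed.

Lemma edges_commuting :
  (2 * #|edges (commuting_graph G)|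
    = (#|A| - #|Z|) * (#|A| - #|Z| - 1) + #|A| * (#|Z| - 1))%N.
Proof.
by rewrite -sum_deg; apply: sum_noncentral_const;
  [apply: commuting_deg_in | apply: commuting_deg_notin].
Qed.

Lemma zagreb1_noncommuting :
  zagreb1 (noncommuting_graph G)
    = ((#|A| - #|Z|) * #|A| ^ 2 + #|A| * (2 * (#|A| - #|Z|)) ^ 2)%N.
Proof.
apply: sum_noncentral_const => x xV.
  by rewrite noncommuting_deg_in.
by rewrite noncommuting_deg_notin.
Qed.

Lemma edges_noncommuting :
  (2 * #|edges (noncommuting_graph G)|
    = (#|A| - #|Z|) * #|A| + #|A| * (2 * (#|A| - #|Z|)))%N.
Proof.
by rewrite -sum_deg; apply: sum_noncentral_const;
  [apply: noncommuting_deg_in | apply: noncommuting_deg_notin].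
Qed.

Lemma zagreb2_noncommuting :
  (2 * zagreb2 (noncommuting_graph G)
    = (#|A| - #|Z|) * (#|A| * (#|A| * (2 * (#|A| - #|Z|))))
      + #|A| * (2 * (#|A| - #|Z|)
                 * ((#|A| - #|Z|) * #|A| + (#|A| - #|Z|) * (2 * (#|A| - #|Z|)))))%N.
Proof.
rewrite zagreb2_double; apply: sum_noncentral_const => x xV.
  rewrite noncommuting_deg_in //; congr (_ * _)%N.
  rewrite big_mkcondr sum_noncentral.
  rewrite [X in (X + _)%N]big1 => [|y yAZ]; last first.
    have [Ay _] := setDP yAZ.
    by rewrite noncommuting_adj_in ?Ay // (subsetP sAG).
  rewrite add0n -{1}card_notin_abelian_index2 -sum_nat_const; apply: eq_bigr => y yGA.
  have [Gy nAy] := setDP yGA.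
  by rewrite noncommuting_adj_in // nAy noncommuting_deg_notin.
have adjx y : y \in A :\: Z -> adj (noncommuting_graph G) x y.
  move=> yAZ; have [Gx nAx] := setDP xV.
  by rewrite adj_sym noncommuting_adj_in.
rewrite noncommuting_deg_notin //; congr (_ * _)%N.
rewrite big_mkcondr sum_noncentral; congr (_ + _)%N.
  rewrite -card_noncentral_in_abelian_index2 -sum_nat_const.
  by apply: eq_bigr => y yAZ; rewrite adjx // noncommuting_deg_in.
(* The neighbours of [x] inside [G :\: A] are counted by subtracting from its total degree those in
   [A :\: Z], all of which are adjacent to [x]. *)
have := noncommuting_deg_notin xV.
rewrite {1}/deg -sum1dep_card big_mkcondr sum_noncentral.
rewrite (eq_bigr (fun=> 1%N)) => [|y yAZ]; last by rewrite adjx.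
rewrite sum1_card card_noncentral_in_abelian_index2 mul2n -addnn => /addnI deg_out.
rewrite -{1}deg_out big_distrl; apply: eq_bigr => y yGA.
by rewrite noncommuting_deg_notin // mul2n -addnn /=; case: ifP; rewrite ?mul1n.
Qed.

End AbelianIndexTwo.

(** * Pulling back the rotations of the dihedral quotient *)

Lemma dihedral_rotation (gT : finGroupType) (L : {group gT}) m :
    (1 < m)%N -> (L \isog 'D_m.*2)%g ->
  #|L| = m.*2 /\ exists2 x, x \in L & #[x]%g = m.
Proof.
move=> m_gt1 isoLD.
have oL : #|L| = m.*2 by rewrite (card_isog isoLD) card_dihedral.
split=> //; have := isoGrp_hom (isoGrp_trans isoLD (Grp_dihedral m_gt1)).
case/existsP=> -[x y] /= /eqP[defL xm y2 xy]; exists x.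
  by rewrite -defL -cycle_subG joing_subl.
have nxy : (<[y]> \subset 'N(<[x]>))%g by rewrite norms_cycle xy groupV cycle_id.
(* The relations only bound the orders from above; equality for [x] comes from [#|L| = m.*2] being
   at most [#[x] * #[y]]. *)
have le_ox : (#[x]%g <= m)%N by rewrite dvdn_leq ?(ltnW m_gt1) // order_dvdn xm.
have le_oy : (#[y]%g <= 2)%N by rewrite dvdn_leq // order_dvdn y2.
apply/eqP; rewrite eqn_leq le_ox -leq_double -!muln2 /=.
apply: leq_trans (leq_mul (leqnn _) le_oy); rewrite muln2 -oL -defL norm_joinEr //.
by rewrite !orderE mul_cardG leq_pmulr ?cardG_gt0.
Qed.

Lemma dihedral_central_quotient_index2 (gT : finGroupType) (G : {group gT}) m :
    (1 < m)%N -> (G / 'Z(G) \isog 'D_(2 * m)%N)%g ->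
  exists A : {group gT},
    [/\ A \subset G, abelian A, #|G : A|%g = 2 & #|A| = (m * #|'Z(G)%g|)%N].
Proof.
move=> m_gt1; rewrite mul2n => /(dihedral_rotation m_gt1)[oGZ [x GZx ox]].
pose A := (coset 'Z(G) @*^-1 <[x]>)%G.
have sAG : A \subset G.
  by rewrite -(quotientGK (center_normal G)) morphpreS ?cycle_subG.
have sZA : ('Z(G) \subset A)%g by apply: sub_cosetpre.
have oA : #|A| = (m * #|'Z(G)%g|)%N by rewrite card_cosetpre -orderE ox mulnC.
exists A; split=> //.
  (* A group that is cyclic modulo a central subgroup is abelian. *)
  apply: (@cyclic_factor_abelian _ 'Z(G)%G).
    by rewrite subsetI sZA (subset_trans (subsetIr G _)) ?centS.
  by rewrite /= cosetpreK cycle_cyclic.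
have := Lagrange (center_sub G); rewrite -(card_quotient (gFnorm _ _)) oGZ.
rewrite -(Lagrange sAG) oA -muln2 [LHS]mulnC -mulnA [(2 * _)%N]mulnC mulnA => /eqP.
by rewrite eqn_pmul2l ?muln_gt0 ?cardG_gt0 ?(ltnW m_gt1) // => /eqP <-.
Qed.

(** * Final formulas and comparison of the averages *)

Lemma ltr_zagreb_ratio (R : realFieldType) (M1 M2 e v : nat) :
    (0 < e)%N -> (0 < v)%N -> (M1 * (2 * e) < 2 * M2 * v)%N ->
  (M1%:R / v%:R < M2%:R / e%:R :> R)%R.
Proof.
move=> e_gt0 v_gt0 lt_M.
rewrite ltr_pdivrMr ?ltr0n // mulrAC ltr_pdivlMr ?ltr0n // -!natrM ltr_nat.
lia.
Qed.

Local Open Scope ring_scope.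

Theorem theorem2p8 (gT : finGroupType) (G : {group gT}) (m n : nat)
    (hm : (3 <= m)%N)
    (hG : (G / 'Z(G) \isog 'D_(2 * m)%N)%g)
    (hn : n = #|'Z(G)%g|) :
  [/\ (zagreb1 (commuting_graph G))%:R
        = n%:R * (m%:R - 1) * (m%:R * n%:R - n%:R - 1) ^+ 2
          + m%:R * n%:R * (n%:R - 1) ^+ 2 :> rat,
      (zagreb2 (commuting_graph G))%:R
        = ((m%:R * n%:R - n%:R) * (m%:R * n%:R - n%:R - 1) ^+ 3
           + m%:R * n%:R * (n%:R - 1) ^+ 3) / 2%:R :> rat,
      (zagreb1 (noncommuting_graph G))%:R
        = n%:R ^+ 3 * (5%:R * m%:R ^+ 3 - 9%:R * m%:R ^+ 2 + 4%:R * m%:R) :> rat,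
      (zagreb2 (noncommuting_graph G))%:R
        = n%:R ^+ 4 * (4%:R * m%:R ^+ 4 - 10%:R * m%:R ^+ 3
                       + 8%:R * m%:R ^+ 2 - 2%:R * m%:R) :> rat
    & forall Gamma : sgraph gT,
        Gamma = commuting_graph G \/ Gamma = noncommuting_graph G ->
        (zagreb2 Gamma)%:R / #|edges Gamma|%:R
          > (zagreb1 Gamma)%:R / #|vertices Gamma|%:R :> rat].
Proof.
have [A [sAG cAA iAG oA]] := dihedral_central_quotient_index2 (ltnW hm) hG.
have nab : ~~ abelian G.
  (* For abelian [G] the central quotient would be trivial, not of order [2 * m]. *)
  apply/negP => /center_idP ZG; move: (card_isog hG).
  rewrite card_quotient ?gFnorm //= ZG indexgg mul2n card_dihedral ?(ltnW hm) //; lia.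
have n_gt0 : (0 < n)%N by rewrite hn cardG_gt0.
have := zagreb1_commuting sAG cAA iAG nab.
have := zagreb2_commuting sAG cAA iAG nab.
have := zagreb1_noncommuting sAG cAA iAG nab.
have := zagreb2_noncommuting sAG cAA iAG nab.
have := edges_commuting sAG cAA iAG nab.
have := edges_noncommuting sAG cAA iAG nab.
have := card_noncentral sAG iAG.
(* Writing [n = j.+1] and [m = k.+3] turns every truncated subtraction into a polynomial in [j] and
   [k]. *)
rewrite {}oA -{}hn; case: n n_gt0 => // j _; case: m hm {hG} => [|[|[|k]]] // _.
have -> : (k.+3 * j.+1 - j.+1 = k.+2 * j.+1)%N by rewrite mulSn addKn.
have -> : (k.+2 * j.+1 - 1 = k.+2 * j + k.+1)%N by lia.
have -> : (2 * (k.+3 * j.+1) - j.+1 = (2 * k + 5) * j.+1)%N by lia.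
have -> : (j.+1 - 1 = j)%N by lia.
move=> vE eN eC M2N M1N M2C M1C.
have natr_half (R : numFieldType) (a b : nat) : (2 * a = b)%N -> a%:R = b%:R / 2%:R :> R.
  by move=> <-; rewrite natrM mulrC mulKf ?pnatr_eq0.
split.
- rewrite M1C; ring.
- rewrite (natr_half _ _ _ M2C); by field.
- rewrite M1N; ring.
- rewrite (natr_half _ _ _ M2N); by field.
move=> Gamma [] ->; apply: ltr_zagreb_ratio; rewrite ?vE ?muln_gt0 ?addn_gt0 ?orbT //.
(* Edges exist even when [j = 0]: the degree on [A :\: Z] is at least [k.+1], thanks to [3 <= m]. *)
- by rewrite -double_gt0 -mul2n eC addn_gt0 !muln_gt0 ?addnS.
- rewrite eC M1C M2C; set p := (k.+2 * j + k.+1)%N.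
  set a := (k.+3 * j.+1)%N; set b := (k.+2 * j.+1)%N.
  set M := (_ * (_ + a * j))%N.
  (* Here [a + b] is the number of vertices, and [k.+1 * j.+1] is [p - j], the difference of the two
     degrees. *)
  have -> : ((b * p ^ 3 + a * j ^ 3) * ((2 * k + 5) * j.+1)
             = M + a * b * (k.+1 * j.+1) ^ 2 * (p + j))%N.
    by rewrite /M /a /b /p; ring.
  by rewrite -[X in (X < _)%N]addn0 ltn_add2l !muln_gt0 /p addnS.
- by rewrite -double_gt0 -mul2n eN addn_gt0 !muln_gt0 ?addnS.
- rewrite eN M1N M2N.
  set a := (k.+3 * j.+1)%N; set b := (k.+2 * j.+1)%N.
  set M := (_ * (b * a + _))%N; set M' := (X in (M < X)%N).
  (* The factor [k.+1 * j.+1] is [2 * b - a], positive because [3 <= m]. *)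
  have -> : (M' = M + a * b ^ 2 * (k.+1 * j.+1) ^ 2)%N.
    by rewrite /M' /M /a /b; ring.
  by rewrite -[X in (X < _)%N]addn0 ltn_add2l !muln_gt0.
Qed.
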